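(* Let $p$ be a prime and let $G$ be a finite Camina $p$-group. (1) If the nilpotency class of $G$ is $2$, then $\mathrm{cod}(G) = \{ 1, p, p\cdot|G/Z(G)|^{1/2} \}$. (2) If the nilpotency class of $G$ is $3$, then $\mathrm{cod}(G) = \{ 1, p, p \cdot |G/G'|^{1/2}, p \cdot |G/Z(G)|^{1/2} \}$.
   Context: For an irreducible complex character $\chi$ of a finite group $G$, its codegree is $\mathrm{cod}(\chi) = |G:\ker\chi|/\chi(1)$, and $\mathrm{cod}(G) = \{\mathrm{cod}(\chi) : \chi \in \mathrm{Irr}(G)\}$. $G'$ is the commutator subgroup. A finite $p$-group $G$ is called a Camina $p$-group if for every $g\in G\setminus G'$ the conjugacy class of $g$ in $G$ equals the coset $gG'$. *)

(* Defs.v *)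
From mathcomp Require Import all_boot all_order all_algebra.
From mathcomp Require Import all_fingroup all_solvable all_field all_character.

Set Implicit Arguments.
Unset Strict Implicit.
Unset Printing Implicit Defensive.

Import GroupScope GRing.Theory.
Local Open Scope ring_scope.

(* Codegrees are taken in algC, where character values live, so that the
   quotient below is a genuine division. *)
Definition codegree (gT : finGroupType) (G : {group gT}) (chi : 'CF(G)) : algC :=
  #|G : cfker chi|%:R / chi 1%g.

(* To be read as a set: only membership matters, not order or repetition. *)
Definition codegrees (gT : finGroupType) (G : {group gT}) : seq algC :=
  [seq codegree chi | chi <- irr G].

Definition camina_pgroup (p : nat) (gT : finGroupType) (G : {group gT}) : Prop :=
  p.-group G /\
  (forall g : gT, g \in G :\: G^`(1)%g -> (g ^: G)%g = (g *: G^`(1))%g).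

(* Main.v *)
(* Being a Camina group means that g outside G' satisfies {[g, x] : x in G} = G',
   a property inherited by all quotients.

   In class 2 this makes G' a space of alternating forms on G/G', over F_p, whose
   nonzero members are all nondegenerate; over a finite field the dimension of
   such a space is at most half that of G/G', so |G'|^2 <= |G : G'|. In class 3
   with |L_3| = p (L_3 the last term of the lower central series), this bound
   applied to G/L_3, together with the count |G : G'| <= |G' : Z(G)|^2, forces
   Z(G) = L_3.

   Now let chi be irreducible. If chi is nonlinear with L_3 in its kernel, then
   Z(chi) = G' and chi(1)^2 = |G : G'|. If L_3 is not in the kernel, the class 3
   statement for G/(L_3 cap ker chi) shows that chi vanishes off L_3, so that
   Z(chi) = Z(G) = L_3 and chi(1)^2 = |G : Z(G)|. In every case Z(chi)/ker chi is
   cyclic of exponent p, whence cod(chi) = p |G : Z(chi)|^(1/2) unless chi = 1. *)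

Require Import Defs.
From mathcomp Require Import all_boot all_order all_algebra.
From mathcomp Require Import all_fingroup all_solvable all_field all_character.
From mathcomp Require Import zify ring.

Set Implicit Arguments.
Unset Strict Implicit.
Unset Printing Implicit Defensive.

Import GroupScope GRing.Theory Num.Theory.
Local Open Scope ring_scope.

(** * Power sums over a finite field *)

(** For [e > 0], [X ^+ e - 1] has at most [e] roots, so some nonzero [a] has [a ^+ e != 1]; scaling
    the variable by [a] multiplies the sum by [a ^+ e]. For [e = 0], translation by 1 leaves the sum
    of all elements unchanged but adds the sum of ones. *)
Lemma sum_expf_eq0 (F : finFieldType) (e : nat) :
  (e < #|F|.-1)%N -> \sum_(a : F) a ^+ e = 0.
Proof.
move=> lt_e; have shiftF (g : F -> F) c : \sum_a g a = \sum_a g (c + a).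
  by rewrite (reindex_inj (addrI c)).
case: e lt_e => [|e] lt_e.
  under eq_bigr => a _ do rewrite expr0.
  apply: (addIr (\sum_(a : F) a)).
  by rewrite add0r -big_split -(shiftF id).
have [/existsP[a /andP[nz_a ae1]]|] := boolP [exists a : F, (a != 0) && (a ^+ e.+1 != 1)].
  have: \sum_(x : F) x ^+ e.+1 = a ^+ e.+1 * \sum_(x : F) x ^+ e.+1.
    rewrite mulr_sumr (reindex_inj (mulfI nz_a)).
    by apply: eq_bigr => x _; rewrite exprMn.
  move/eqP; rewrite -subr_eq0 -{1}[\sum_x _]mul1r -mulrBl mulf_eq0 subr_eq0.
  by rewrite eq_sym (negPf ae1) => /eqP.
rewrite negb_exists => /forallP all1; have: (e.+1 < e.+1)%N; last by rewrite ltnn.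
have rootsF: all (root ('X^(e.+1) - 1%:P)) (enum (predC1 (0 : F))).
  apply/allP=> a; rewrite mem_enum inE => nz_a; have:= all1 a.
  by rewrite rootE !hornerE nz_a /= negbK => /eqP->; rewrite subrr.
have szP : size ('X^(e.+1) - 1%:P : {poly F}) = e.+2 by rewrite size_XnsubC.
apply: leq_trans lt_e _.
have nzP : ('X^(e.+1) - 1%:P : {poly F}) != 0 by rewrite -size_poly_eq0 szP.
have := max_poly_roots nzP rootsF (enum_uniq _).
by rewrite szP ltnS -cardE cardC1.
Qed.

(* The Chevalley-Warning argument: after expansion every monomial has an
   exponent below [#|F|.-1]. *)
Lemma sum_prod_linear_eq0 (F : finFieldType) (n : nat) (J : finType)
    (l : J -> 'I_n -> F) :
  (#|J| < n * #|F|.-1)%N ->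
  \sum_(y : {ffun 'I_n -> F}) \prod_j (\sum_k y k * l j k) = 0.
Proof.
move=> lt_J; under eq_bigr => y _ do rewrite bigA_distr_bigA /=.
rewrite exchange_big big1 //= => f _.
(* The exponent of the [k]-th variable in the monomial selected by [f]. These exponents add up to
   [#|J|], so they cannot all reach [#|F|.-1]. *)
pose e k := #|[set j | f j == k]|.
have prodE (y : {ffun 'I_n -> F}) :
    \prod_j (y (f j) * l j (f j)) = (\prod_j l j (f j)) * \prod_k y k ^+ e k.
  rewrite big_split mulrC /=; congr (_ * _).
  rewrite (partition_big f xpredT) //=; apply: eq_bigr => k _.
  rewrite -prodr_const; apply: eq_big => [j|j /eqP->//]; by rewrite inE.
under eq_bigr => y _ do rewrite prodE.
rewrite -mulr_sumr -(bigA_distr_bigA (fun k a => a ^+ e k)) /=.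
have [/existsP[k lt_k]|] := boolP [exists k, e k < #|F|.-1]%N.
  by rewrite (bigD1 k) //= sum_expf_eq0 // mul0r mulr0.
rewrite negb_exists => /forallP ge_e; move: lt_J; rewrite ltnNge => /negP[].
have ->: #|J| = (\sum_k e k)%N.
  rewrite -cardsT -sum1_card (partition_big f xpredT) //=; apply: eq_bigr => k _.
  by rewrite /e -sum1_card; apply: eq_bigl => j; rewrite !inE.
rewrite -{1}[n]card_ord -sum_nat_const; apply: leq_sum => k _.
by rewrite leqNgt.
Qed.

(** * Alternating matrices and their determinants *)

(** In characteristic 2 this is stronger than skew symmetry. *)
Definition alternating (R : comNzRingType) n (A : 'M[R]_n) :=
  forall v : 'rV_n, v *m A *m v^T = 0.

Lemma alternating_congr (R : comNzRingType) m n (A : 'M[R]_n) (X : 'M_(m, n)) :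
  alternating A -> alternating (X *m A *m X^T).
Proof. by move=> altA v; rewrite !mulmxA -mulmxA -trmx_mul altA. Qed.

Lemma alternatingD (R : comNzRingType) n (A B : 'M[R]_n) :
  alternating A -> alternating B -> alternating (A + B).
Proof. by move=> aA aB v; rewrite mulmxDr mulmxDl aA aB addr0. Qed.

Lemma alternating_tr (R : comNzRingType) n (A : 'M[R]_n) :
  alternating A -> A^T = - A.
Proof.
move=> altA; have altE (u v : 'rV_n) : u *m A *m v^T + v *m A *m u^T = 0.
  have := altA (u + v); rewrite !(mulmxDl, mulmxDr, linearD) /= !altA.
  by rewrite add0r addr0 addrC.
apply/matrixP=> i j; rewrite !mxE; apply/eqP; rewrite -addr_eq0 addrC.
have /matrixP/(_ 0 0) := altE (delta_mx 0 i) (delta_mx 0 j).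
rewrite -!rowE !trmx_delta -!colE !mxE => ->; exact: eqxx.
Qed.

Lemma alternating_diag (R : comNzRingType) n (A : 'M[R]_n) i :
  alternating A -> A i i = 0.
Proof.
move=> /(_ (delta_mx 0 i)) /matrixP/(_ 0 0).
by rewrite -!rowE !trmx_delta -!colE !mxE.
Qed.

(** With [v = w A], the value at [v] is [w (w A)^T = - w A w^T]. *)
Lemma alternating_inv (F : fieldType) n (A : 'M[F]_n) :
  A \in unitmx -> alternating A -> alternating (invmx A).
Proof.
move=> uA altA v; set w := v *m invmx A.
have ->: v = w *m A by rewrite /w mulmxKV.
by rewrite trmx_mul (alternating_tr altA) mulNmx mulmxN mulmxA altA oppr0.
Qed.

(** The root is the Pfaffian up to sign. A nonzero entry of the first row is moved next to the
    diagonal by a congruence, and the induction goes on with the Schur complement of the resulting 2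
    by 2 block. *)
Lemma alternating_det_square (F : fieldType) n (A : 'M[F]_n) :
  alternating A -> exists b, \det A = b ^+ 2.
Proof.
elim/ltn_ind: n A => -[|[|k]] IH A altA.
- by exists 1; rewrite det_mx00 expr1n.
- by exists 0; rewrite det_mx11 alternating_diag // expr0n.
have [/existsP[j nzj]|] := boolP [exists j, A 0 j != 0]; last first.
  rewrite negb_exists => /forallP A0; exists 0; rewrite expr0n /=.
  rewrite (expand_det_row A 0) big1 // => j _.
  by have := A0 j; rewrite negbK => /eqP->; rewrite mul0r.
pose X : 'M[F]_k.+2 := tperm_mx 1 j.
pose B : 'M_(2 + k) := X *m A *m X^T.
have altB : alternating B by apply: alternating_congr.
have nz_j : j != 0 by apply: contraNneq nzj => ->; rewrite alternating_diag.
have B01 : B 0 1 = A 0 j.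
  rewrite /B tr_tperm_mx -xcolE -xrowE !mxE.
  by rewrite tpermL tpermD // eq_sym.
have detB : \det B = \det A.
  rewrite !det_mulmx det_tr mulrAC -expr2 det_perm -exprM.
  by rewrite mulnC exprM sqrrN !expr1n mul1r.
clearbody B; clear X.
pose P := ulsubmx B; pose Y := ursubmx B; pose S := drsubmx B.
have BE : B = block_mx P Y (- Y^T) S.
  rewrite -[LHS]submxK; congr block_mx; rewrite /Y trmx_ursub.
  by rewrite (alternating_tr altB); apply/matrixP=> a b; rewrite !mxE opprK.
have subE (v : 'rV_2) (w : 'rV_k) : row_mx v w *m B *m (row_mx v w)^T = 0.
  exact: altB.
have altP : alternating P.
  move=> v; have := subE v 0; rewrite BE tr_row_mx mul_row_block mul_row_col.
  by rewrite !mul0mx linear0 mulmx0 !addr0.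
have altS : alternating S.
  move=> v; have := subE 0 v; rewrite BE tr_row_mx mul_row_block mul_row_col.
  by rewrite !mul0mx linear0 mulmx0 !add0r.
have detP : \det P = A 0 j ^+ 2.
  have P10 : P 1 0 = - P 0 1.
    by have /matrixP/(_ 0 1) := alternating_tr altP; rewrite !mxE.
  have <- : P 0 1 = A 0 j by rewrite -B01 !mxE; congr (B _ _); exact: val_inj.
  rewrite (expand_det_row _ 0) !big_ord_recl big_ord0 /cofactor !det_mx11.
  rewrite (alternating_diag 0 altP) mul0r add0r addr0 [X in _ * (_ * X)]mxE.
  rewrite [X in _ * (_ * X)]mxE.
  have -> : lift 0 0 = 1 :> 'I_2 by exact: val_inj.
  have -> : lift 1 0 = 0 :> 'I_2 by exact: val_inj.
  by rewrite P10 expr1 mulN1r opprK expr2.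
have uP : P \in unitmx by rewrite unitmxE detP unitfE expf_neq0.
(* The Schur complement of [P]; the plus sign is due to the lower left block being [- Y^T]. The
   second summand is congruent to the inverse of [P], hence alternating. *)
pose T := S + Y^T *m invmx P *m Y.
have altT : alternating T.
  apply: alternatingD => //; rewrite -[X in _ *m X]trmxK.
  exact/alternating_congr/alternating_inv.
have [b detT] := IH k (ltnW (ltnSn _)) T altT.
exists (A 0 j * b); rewrite exprMn -detP -detT -detB -(det_ublock P Y T) {1}BE.
have -> : block_mx P Y (- Y^T) S
  = block_mx 1%:M 0 (- Y^T *m invmx P) 1%:M *m block_mx P Y 0 T.
  rewrite mulmx_block !mul1mx !mul0mx !addr0 mulmxKV //.
  by rewrite /T mulNmx mulNmx addrC addrK.
by rewrite det_mulmx det_lblock !det1 !mul1r.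
Qed.

(* The determinant of a nonzero combination of the [A k] is a nonzero square, so
   its power [#|F|.-1./2] is 1; but Chevalley-Warning makes the sum of these
   powers vanish when [m < 2 * n]. *)
Lemma alternating_space_odd (F : finFieldType) (m n : nat)
    (A : 'I_n -> 'M[F]_m) :
    odd #|F| -> (0 < m)%N -> (forall k, alternating (A k)) ->
    (forall y : 'rV_n, y != 0 -> \sum_k y 0 k *: A k \in unitmx) ->
  (2 * n <= m)%N.
Proof.
move=> oddF m_gt0 altA regA; rewrite leqNgt; apply/negP=> lt_m.
pose e := #|F|.-1./2; have F1 := finRing_gt1 F.
have De : #|F|.-1 = (2 * e)%N.
  rewrite mul2n -[LHS]odd_double_half; move: oddF.
  by rewrite -{1}(prednK (ltnW F1)) /= => /negPf->.
have e_gt0 : (0 < e)%N by rewrite -(ltn_pmul2l (isT : 0 < 2)%N) -De -subn1 subn_gt0.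
have n_gt0 : (0 < n)%N by rewrite -(ltn_pmul2l (isT : 0 < 2)%N) (leq_trans _ lt_m).
pose Ay (y : {ffun 'I_n -> F}) := \sum_k y k *: A k.
have altAy y : alternating (Ay y).
  move=> v; rewrite /Ay mulmx_sumr mulmx_suml big1 // => k _.
  by rewrite -scalemxAr -scalemxAl altA scaler0.
have sum0 : \sum_y \det (Ay y) ^+ e = 0.
  (* The Leibniz terms, which turn [\det (Ay y) ^+ e] into a sum of products of [e * m] linear forms
     in [y]. This number is below [n * #|F|.-1 = 2 * n * e] because [m < 2 * n]. *)
  pose g (y : {ffun 'I_n -> F}) (s : 'S_m) : F :=
    (-1) ^+ s * \prod_i (\sum_k y k * A k i (s i)).
  have detE y : \det (Ay y) = \sum_(s : 'S_m) g y s.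
    rewrite /determinant; apply: eq_bigr => s _; congr (_ * _).
    apply: eq_bigr => i _; rewrite /Ay summxE; apply: eq_bigr => k _.
    by rewrite mxE.
  have powE y : \det (Ay y) ^+ e =
      \sum_(f : {ffun 'I_e -> 'S_m}) \prod_(t < e) g y (f t).
    rewrite detE -(bigA_distr_bigA (fun=> g y)) /=.
    by rewrite prodr_const card_ord.
  under eq_bigr => y _ do rewrite powE.
  rewrite exchange_big big1 //= => f _.
  under eq_bigr => y _ do rewrite big_split /= pair_bigA /=.
  rewrite -mulr_sumr.
  rewrite (@sum_prod_linear_eq0 F n _ (fun j k => A k j.2 (f j.1 j.2))) ?mulr0 //.
  by rewrite card_prod !card_ord De mulnCA mulnA (mulnC e m) ltn_pmul2r.
have cardF0 : #|F|%:R = 0 :> F.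
  rewrite -sumr_const -[RHS](@sum_expf_eq0 F 0); last by rewrite De muln_gt0.
  by apply: eq_bigr => x _; rewrite expr0.
have unitE y : y != 0 -> \det (Ay y) ^+ e = 1.
  move=> nz_y; have [k nz_yk] : exists k, y k != 0.
    apply/existsP; apply: contraNT nz_y; rewrite negb_exists => /forallP y0.
    by apply/eqP/ffunP=> k; rewrite ffunE; apply/eqP; have := y0 k; rewrite negbK.
  have /regA : \row_k y k != 0 by apply/rV0Pn; exists k; rewrite mxE.
  under eq_bigr do rewrite mxE; rewrite unitmxE unitfE -/(Ay y).
  have [b ->] := alternating_det_square (altAy y).
  rewrite expf_eq0 /= => nz_b; rewrite -exprM -De.
  by apply: (mulfI nz_b); rewrite mulr1 -exprS prednK ?expf_card // ltnW.
move: sum0; rewrite (bigD1 (0 : {ffun 'I_n -> F})) //= (eq_bigr (fun=> 1)) => [|y /unitE//].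
have -> : Ay 0 = 0 by rewrite /Ay big1 // => k _; rewrite ffunE scale0r.
case: m m_gt0 {A altA regA lt_m Ay altAy unitE} => // m _.
rewrite det0 expr0n eqn0Ngt e_gt0 add0r sumr_const => sum0.
(* The number of all [y] and the number of nonzero [y] differ by one, yet both vanish in [F]. *)
have := cardF0; have: #|{ffun 'I_n -> F}|%:R = 0 :> F.
  by rewrite card_ffun card_ord -(prednK n_gt0) expnS natrM cardF0 mul0r.
have -> : #|{ffun 'I_n -> F}| = #|predC1 (0 : {ffun 'I_n -> F})|.+1.
  by rewrite cardC1 prednK //; apply/card_gt0P; exists 0.
have {}sum0 : #|predC1 (0 : {ffun 'I_n -> F})|%:R = 0 :> F.
  by rewrite -[RHS]sum0; congr _%:R; apply: eq_card.
by rewrite mulrSr sum0 add0r => /eqP; rewrite oner_eq0.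
Qed.

(** * Characteristic two: Gauss sums of quadratic forms *)

(** The nontrivial additive character of ['F_2], with integer values to allow divisibility
    arguments. *)
Definition sgnF2 (a : 'F_2) : int := (-1) ^+ (a != 0).

Lemma F2_cases (a : 'F_2) : a = 0 \/ a = 1.
Proof. by case: a => [[|[|a]] lt_a] //; [left | right]; apply: val_inj. Qed.

Lemma sgnF2D a b : sgnF2 (a + b) = sgnF2 a * sgnF2 b.
Proof. by case: (F2_cases a) (F2_cases b) => [] -> [] ->. Qed.

Lemma sgnF2_polar a b c : sgnF2 a * sgnF2 (a + b + c) = sgnF2 b * sgnF2 c.
Proof.
rewrite !sgnF2D.
by case: (F2_cases a) => ->; rewrite ?mulN1r ?mul1r ?mulNr ?opprK.
Qed.

(** Orthogonality of characters: if [c i 0 = 1], translating [w] by the [i]-th basis vector changes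
    the sign of the sum. *)
Lemma sum_sgnF2_linear n (c : 'cV['F_2]_n) :
  \sum_(w : 'rV_n) sgnF2 ((w *m c) 0 0) = if c == 0 then (2 ^ n)%:Z else 0.
Proof.
case: eqVneq => [-> | /cV0Pn[i nz_ci]].
  under eq_bigr => w _ do rewrite mulmx0 mxE.
  by rewrite sumr_const card_mx card_Fp // mul1n -mulr_natr mul1r natz.
have ci1 : c i 0 = 1 by case: (F2_cases (c i 0)) nz_ci => -> //; rewrite eqxx.
set X := \sum_w _; suff: X = - X by lia.
rewrite {1}/X (reindex_inj (addrI (delta_mx 0 i))) -sumrN /=.
apply: eq_bigr => w _; rewrite mulmxDl -rowE [in LHS]mxE [in LHS]mxE.
by rewrite ci1 sgnF2D mulN1r.
Qed.

(* With [Q] a vector of quadratic forms polarising to the [A k], the integer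
   [S y], a Gauss sum, has square [2 ^ m] for [y != 0], while the sum of all the
   [S y] is [2 ^ n] times the number of common zeros of [Q]. *)
Lemma alternating_space_F2 (m n : nat) (A : 'I_n -> 'M['F_2]_m) :
    (0 < m)%N -> (forall k, alternating (A k)) ->
    (forall y : 'rV_n, y != 0 -> \sum_k y 0 k *: A k \in unitmx) ->
  (2 * n <= m)%N.
Proof.
move=> m_gt0 altA regA; rewrite leqNgt; apply/negP=> lt_m.
(* The strict upper triangle defines a quadratic form with polar form [A k], since [-1 = 1]. *)
pose U k := \matrix_(i, j) if (i < j)%N then A k i j else 0.
have AE k : A k = U k + (U k)^T.
  apply/matrixP=> i j; rewrite !mxE; case: ltngtP => [_ | _ | /val_inj->].
  - by rewrite addr0.
  - have /matrixP/(_ i j) := alternating_tr (altA k); rewrite !mxE add0r => ->.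
    by apply: val_inj; case: (F2_cases (A k i j)) => ->.
  - by rewrite alternating_diag ?addr0.
pose Q (v : 'rV_m) := \col_k (v *m U k *m v^T) 0 0 : 'cV['F_2]_n.
pose Ay (y : 'rV_n) := \sum_k y 0 k *: A k.
have QD (y : 'rV_n) (w u : 'rV_m) :
    (y *m Q (w + u)) 0 0 = (y *m Q w) 0 0 + (y *m Q u) 0 0 + (w *m (Ay y *m u^T)) 0 0.
  have -> : w *m (Ay y *m u^T) = \sum_k y 0 k *: (w *m U k *m u^T + u *m U k *m w^T).
    rewrite mulmx_suml mulmx_sumr; apply: eq_bigr => k _.
    rewrite -scalemxAl -scalemxAr AE; congr (_ *: _).
    rewrite mulmxDl mulmxDr !mulmxA; congr (_ + _).
    have tr11 (M : 'M['F_2]_1) : M = M^T by apply/matrixP=> i j; rewrite !ord1 mxE.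
    by rewrite [RHS]tr11 !trmx_mul trmxK mulmxA.
  have qE v : (y *m Q v) 0 0 = \sum_k y 0 k * (v *m U k *m v^T) 0 0.
    by rewrite mxE; apply: eq_bigr => k _; rewrite mxE.
  have addE (M N : 'M['F_2]_1) : (M + N) 0 0 = M 0 0 + N 0 0 by rewrite mxE.
  rewrite !qE summxE -!big_split /=; apply: eq_bigr => k _.
  rewrite [X in _ = _ + X]mxE -!mulrDr -!addE; congr (_ * (_ : 'M_1) 0 0).
  by rewrite linearD /= !(mulmxDl, mulmxDr) -!addrA; congr (_ + _); rewrite addrA addrC.
have Q0 : Q 0 = 0 by apply/colP=> k; rewrite mxE !mul0mx !mxE.
have uAy y : y != 0 -> Ay y \in unitmx by apply: regA.
clearbody Q Ay.
pose S (y : 'rV_n) := \sum_(v : 'rV_m) sgnF2 ((y *m Q v) 0 0).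
(* Substituting [w + u] for the second variable leaves, for each [u], a character sum in [w]; as
   [Ay y] is invertible, only [u = 0] contributes. *)
have S2 y : y != 0 -> S y ^+ 2 = (2 ^ m)%:Z.
  move=> nz_y; have uA := uAy y nz_y.
  have -> : S y ^+ 2 = \sum_u sgnF2 ((y *m Q u) 0 0) *
                         \sum_(w : 'rV_m) sgnF2 ((w *m (Ay y *m u^T)) 0 0).
    under [RHS]eq_bigr do rewrite mulr_sumr.
    rewrite exchange_big expr2 mulr_suml; apply: eq_bigr => w _ /=.
    rewrite mulr_sumr (reindex_inj (addrI w)); apply: eq_bigr => u _ /=.
    by rewrite QD sgnF2_polar.
  rewrite (bigD1 (0 : 'rV_m)) //= [X in _ + X]big1 => [|u nz_u].
    by rewrite Q0 mulmx0 mxE mul1r addr0 trmx0 mulmx0 sum_sgnF2_linear eqxx.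
  rewrite sum_sgnF2_linear; case: eqP => [Au0|_]; last by rewrite mulr0.
  case/eqP: nz_u; apply: trmx_inj; rewrite trmx0.
  by rewrite -[LHS](mulKmx uA) Au0 mulmx0.
have dvd_sum : ((2 ^ n)%:Z %| \sum_y S y)%Z.
  rewrite exchange_big /=; apply: rpred_sum => v _.
  by rewrite sum_sgnF2_linear; case: ifP => _; rewrite ?dvdz0 ?dvdzz.
have n_gt0 : (0 < n)%N by rewrite -(ltn_pmul2l (isT : 0 < 2)%N) (leq_trans _ lt_m).
have absS y : y != 0 -> exists2 k, m = (k * 2)%N & `|S y|%N = (2 ^ k)%N.
  move/S2=> /(congr1 absz); rewrite abszX absz_nat => Sm.
  have /(dvdn_pfactor _ _ (isT : prime 2))[k le_k Sk] : (`|S y| %| 2 ^ m)%N.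
    by rewrite -Sm dvdn_exp.
  exists k => //; apply/eqP; rewrite -(eqn_exp2l (m := 2)) // -Sm Sk.
  by rewrite -expnM.
(* The constant vector is just some nonzero [y]; what is extracted is that [m] is even. *)
have [k Dm _] : exists2 k, m = (k * 2)%N & `|S (const_mx 1%R)|%N = (2 ^ k)%N.
  by apply: absS; apply/rV0Pn; exists (Ordinal n_gt0); rewrite mxE.
have k_gt0 : (0 < k)%N by move: m_gt0; rewrite Dm muln_gt0 => /andP[].
have lt_kn : (k < n)%N by move: lt_m; rewrite Dm mulnC ltn_pmul2l.
have S0 : S 0 = (2 ^ m)%:Z.
  rewrite /S; under eq_bigr => v _ do rewrite mul0mx mxE.
  by rewrite sumr_const card_mx card_Fp // mul1n -mulr_natr mul1r natz.
have dvdX a : (k < a)%N -> ((2 ^ k.+1)%:Z %| (2 ^ a)%:Z)%Z.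
  by move=> lt_ka; rewrite dvdzE /= dvdn_exp2l.
have S_mod y : y != 0 -> ((2 ^ k.+1)%:Z %| S y - (2 ^ k)%:Z)%Z.
  case/absS=> k'; rewrite Dm => /eqP; rewrite eqn_pmul2r // => /eqP <- Sk.
  have [->|->] : S y = (2 ^ k)%:Z \/ S y = - (2 ^ k)%:Z by lia.
    by rewrite subrr dvdz0.
  by rewrite -opprD rpredN -PoszD addnn -mul2n -expnS dvdzz.
have: ((2 ^ k.+1)%:Z %| (2 ^ k)%:Z)%Z; last first.
  by rewrite dvdzE /= dvdn_Pexp2l // ltnn.
have card_nz : #|predC1 (0 : 'rV['F_2]_n)| = (2 ^ n).-1.
  by rewrite cardC1 card_mx card_Fp // mul1n.
(* An identity, as there are [2 ^ n - 1] nonzero [y]. Each term on the right is divisible by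
   [2 ^ k.+1], because [0 < k < n] and [S y] is plus or minus [2 ^ k] for [y != 0]. *)
have -> : (2 ^ k)%:Z = S 0 + (2 ^ (n + k))%:Z
    + \sum_(y | y != 0) (S y - (2 ^ k)%:Z) - \sum_y S y.
  rewrite [X in _ - X](bigD1 (0 : 'rV_n)) //= sumrB sumr_const.
  rewrite (eq_card (B := predC1 (0 : 'rV['F_2]_n))) // card_nz.
  rewrite expnD -(prednK (expn_gt0 2 n)) mulSn PoszD PoszM -mulr_natr natz mulrC.
  by ring.
have dvdS : \sum_y S y \in dvdz (2 ^ k.+1)%:Z by exact: dvdz_trans (dvdX _ lt_kn) dvd_sum.
by rewrite rpredB // rpredD ?rpred_sum // rpredD ?S0 ?dvdX //; lia.
Qed.

Lemma alternating_space_Fp (p m n : nat) (A : 'I_n -> 'M['F_p]_m) :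
    prime p -> (0 < m)%N -> (forall k, alternating (A k)) ->
    (forall y : 'rV_n, y != 0 -> \sum_k y 0 k *: A k \in unitmx) ->
  (2 * n <= m)%N.
Proof.
move=> p_pr; have [p2 | oddp] := even_prime p_pr.
  by rewrite {}p2 in A *; apply: alternating_space_F2.
by apply: alternating_space_odd; rewrite card_Fp.
Qed.

(** * Groups whose commutators fill G', and their power structure in class two *)

Section CommutatorsOnto.

Local Open Scope group_scope.

Definition commutators_onto (gT : finGroupType) (G : {group gT}) :=
  forall g z, g \in G :\: G^`(1) -> z \in G^`(1) ->
  exists2 x, x \in G & [~ g, x] = z.

Lemma camina_commutators_onto p (gT : finGroupType) (G : {group gT}) :
  camina_pgroup p G -> commutators_onto G.
Proof.
case=> _ caminaG g z Gg Gz; have: g * z \in g *: G^`(1) by rewrite mem_lcoset mulKg.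
rewrite -caminaG // => /imsetP[x Gx gz]; exists x => //.
by rewrite commgEl -gz mulKg.
Qed.

Lemma commutators_onto_quotient (gT : finGroupType) (G N : {group gT}) :
  G \subset 'N(N) -> commutators_onto G -> commutators_onto (G / N).
Proof.
move=> nNG ontoG gb zb; rewrite -quotient_der // => /setDP[/morphimP[g Ng Gg ->] gG'].
case/morphimP=> z Nz G'z ->.
have [|x Gx <-] := ontoG g z _ G'z.
  by rewrite inE Gg andbT; apply: contra gG'; apply: mem_quotient.
by exists (coset N x); rewrite ?mem_quotient // morphR ?(subsetP nNG).
Qed.

Variables (gT : finGroupType) (G : {group gT}).
Hypothesis ontoG : commutators_onto G.

(** A central element has only trivial commutators, so outside G' they could not fill G'. *)
Lemma center_sub_der1 : G^`(1) != 1 -> 'Z(G) \subset G^`(1).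
Proof.
case/trivgPn=> c G'c nt_c; apply/subsetP=> z Zz; apply: contraNT nt_c => G'z.
have [|x Gx <-] := @ontoG z c _ G'c; first by rewrite inE G'z (subsetP (center_sub G)).
by apply/commgP; case/centerP: Zz => _; apply.
Qed.

Variable p : nat.
Hypotheses (pG : p.-group G) (cG' : G^`(1) \subset 'Z(G)).

Lemma der1_comm_central x y z : x \in G -> y \in G -> z \in G -> commute [~ x, y] z.
Proof.
move=> Gx Gy Gz; have /centerP[_] := subsetP cG' _ (mem_commg Gx Gy); exact.
Qed.

(** If [g ^+ p] were outside G', each element of G' would be some [[~ g ^+ p, x] = [~ g, x] ^+ p].
    The [p]-th power map would then be onto G', hence injective, against Cauchy's theorem. *)
Lemma expg_mem_der1 g : G^`(1) != 1 -> g \in G -> g ^+ p \in G^`(1).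
Proof.
move=> ntG' Gg; apply: contraR ntG' => gpG'.
have gG' : g \in G :\: G^`(1).
  by rewrite inE Gg andbT; apply: contra gpG'; apply: groupX.
have gpD : g ^+ p \in G :\: G^`(1) by rewrite inE gpG' groupX.
have sG'X : G^`(1) \subset [set z ^+ p | z in G^`(1)].
  apply/subsetP=> z /(ontoG gpD)[x Gx <-]; apply/imsetP.
  exists [~ g, x]; first exact: mem_commg.
  exact/commXg/esym/der1_comm_central.
have /imset_injP injX : #|[set z ^+ p | z in G^`(1)]| == #|G^`(1)|.
  by rewrite eqn_leq leq_imset_card subset_leq_card.
have [//|ntG'] := eqVneq (G^`(1)) 1.
have [p_pr p_dv _] := pgroup_pdiv (pgroupS (der_sub 1 G) pG) ntG'.
have [z G'z oz] := Cauchy p_pr p_dv.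
have := injX z 1 G'z (group1 _); rewrite -oz expg_order expg1n => /(_ erefl) z1.
by move: p_pr; rewrite -oz z1 order1.
Qed.

Lemma der1_quotient_abelem : prime p -> G^`(1) != 1 -> p.-abelem (G / G^`(1)).
Proof.
move=> p_pr ntG'; rewrite abelemE // der_abelian; apply/exponentP=> _ /morphimP[x Nx Gx ->].
by rewrite -morphX //= coset_id // expg_mem_der1.
Qed.

(** Each [z] in G' is some [[~ g, x]], and [z ^+ p = [~ g ^+ p, x]] is trivial because [g ^+ p] lies
    in G', which is central. *)
Lemma der1_abelem : prime p -> p.-abelem G^`(1).
Proof.
move=> p_pr; rewrite abelemE //.
have abG' : abelian G^`(1).
  by apply: abelianS cG' (center_abelian G).
rewrite abG'; apply/exponentP=> z G'z.
have [->|nt_z] := eqVneq z 1; first by rewrite expg1n.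
have ntG' : G^`(1) != 1 by apply/trivgPn; exists z.
have ntG : G :!=: 1 by apply: contraNneq ntG' => ->; rewrite derg1 comm1G.
have /properP[_ [g Gg gG']] : G^`(1) \proper G by exact: sol_der1_proper (pgroup_sol pG) _ ntG.
have [|x Gx <-] := @ontoG g z _ G'z; first by rewrite inE gG'.
rewrite -commXg; last exact/esym/der1_comm_central.
apply/eqP/commgP; have /centerP[_] := subsetP cG' _ (expg_mem_der1 ntG' Gg); exact.
Qed.

End CommutatorsOnto.

(** * The commutator map in coordinates over the prime field *)

(** Scalars in ['F_p] are multiples of 1, so additivity gives linearity. *)
Lemma additive_Fp_rowE (p m : nat) (h : 'rV['F_p]_m -> 'F_p) (v : 'rV_m) :
    {morph h : u w / u + w} ->
  h v = \sum_i v 0 i * h (delta_mx 0 i).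
Proof.
move=> hD; have h0 : h 0 = 0 by apply: (addrI (h 0)); rewrite -hD !addr0.
rewrite {1}[v]row_sum_delta (big_morph h hD h0); apply: eq_bigr => i _.
have hMn n u : h (u *+ n) = h u *+ n.
  by elim: n => [|n IH]; rewrite ?mulr0n // !mulrS hD IH.
by rewrite -[v 0 i]natr_Zp scaler_nat hMn mulr_natl.
Qed.

Lemma biadditive_Fp_mxE (p m : nat) (h : 'rV['F_p]_m -> 'rV['F_p]_m -> 'F_p)
    (v w : 'rV_m) :
    (forall u, {morph h u : v w / v + w}) ->
    (forall u, {morph h^~ u : v w / v + w}) ->
  h v w = (v *m (\matrix_(i, j) h (delta_mx 0 i) (delta_mx 0 j)) *m w^T) 0 0.
Proof.
move=> hDr hDl; rewrite -mulmxA (additive_Fp_rowE (h := h^~ w)) // mxE.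
apply: eq_bigr => i _; congr (_ * _); rewrite (additive_Fp_rowE (h := h _)) // mxE.
by apply: eq_bigr => j _; rewrite !mxE mulrC.
Qed.

(* The commutator map makes G' a dual space of alternating forms on G/G', all
   of them nondegenerate but 0. *)
Lemma der1_square_bound (p : nat) (gT : finGroupType) (G : {group gT}) :
    prime p -> p.-group G -> commutators_onto G -> (G^`(1) \subset 'Z(G))%g ->
  (#|G^`(1)%g| ^ 2 <= #|G : G^`(1)%g|)%N.
Proof.
move=> p_pr pG ontoG cG'; have [->|ntE] := eqVneq (G^`(1)%g) 1%g.
  by rewrite cards1 indexg1 exp1n cardG_gt0.
have abA := der1_quotient_abelem ontoG pG cG' p_pr ntE.
have abE := der1_abelem ontoG pG cG' p_pr.
have nG' : G \subset 'N(G^`(1)%g) by exact: der_norm.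
have ntA : (G / G^`(1))%g != 1%g.
  rewrite -subG1 quotient_sub1 //; apply/negP=> sGG'.
  have ntG : G :!=: 1%g by apply: contraNneq ntE => ->; rewrite derg1 comm1G.
  have := sol_der1_proper (pgroup_sol pG) (subxx G) ntG.
  by rewrite properE sGG' andbF.
pose rA := rVabelem abA ntA; pose rE := abelem_rV abE ntE.
pose lift v := repr (rA v).
have coset_lift v : coset G^`(1) (lift v) = rA v by exact: coset_reprK.
have Nlift v : lift v \in 'N(G^`(1)%g) by exact: repr_coset_norm.
have Glift v : lift v \in G.
  by rewrite -(quotientGK (der_normal 1 G)) mem_morphpre //= coset_lift mem_rVabelem.
have commE v x y : coset G^`(1) x = rA v -> x \in G -> y \in G ->
    [~ x, y]%g = [~ lift v, y]%g.
  rewrite -coset_lift => eq_xv Gx Gy.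
  have /rcosetP[c G'c ->] : (x \in G^`(1) :* lift v)%g.
    by apply/rcoset_kercosetP; rewrite // (subsetP nG').
  rewrite commMgJ (_ : [~ c, y]%g = 1%g) ?conj1g ?mul1g //.
  by apply/eqP/commgP; have /centerP[_] := subsetP cG' _ G'c; apply.
pose f v w := rE [~ lift v, lift w]%g.
have fV v w : f w v = - f v w.
  by rewrite /f -invg_comm /rE abelem_rV_V ?mem_commg.
have fDl w : {morph f^~ w : u v / u + v}.
  move=> u v; rewrite /f -(commE _ (lift u * lift v)%g) ?groupM //; last first.
    by rewrite morphM ?(subsetP nG') //= !coset_lift -rVabelemD.
  rewrite commMgJ conjgE (der1_comm_central cG') // mulKg /rE.
  by rewrite abelem_rV_M ?mem_commg.
have fDr w : {morph f w : u v / u + v}.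
  by move=> u v; rewrite !(fV _ w) fDl opprD.
pose A k := \matrix_(i, j) f (delta_mx 0 i) (delta_mx 0 j) 0 k.
have AE k v w : f v w 0 k = (v *m A k *m w^T) 0 0.
  apply: (biadditive_Fp_mxE (h := fun v w => f v w 0 k)) => u v' w' /=.
    by rewrite fDr mxE.
  by rewrite fDl mxE.
have altA k : alternating (A k).
  move=> v; apply/matrixP=> i j; rewrite !ord1 -AE /f (_ : [~ _, _]%g = 1%g).
    by rewrite /rE abelem_rV_1 !mxE.
  exact/eqP/commgP.
(* A nonzero [v] killed by [B] lifts outside G', so some [w] makes [f v w] the [k]-th basis vector,
   with [y 0 k != 0]. Then [B] pairs [v] and [w] to [y 0 k], a contradiction. *)
have regA (y : 'rV_('dim G^`(1)%g)) : y != 0 -> \sum_k y 0 k *: A k \in unitmx.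
  set B := \sum_k _ => nz_y; rewrite -row_free_unit -kermx_eq0.
  apply: contraT => /rowV0Pn[v /sub_kermxP vB0 nz_v].
  have [k nz_yk] := rV0Pn _ nz_y.
  have Gv : lift v \in G :\: G^`(1)%g.
    rewrite inE Glift andbT; apply: contra nz_v => /coset_id.
    rewrite coset_lift => rAv1; apply/eqP/(@rVabelem_inj _ _ _ abA ntA).
    by rewrite rVabelem0 -rAv1.
  have [x Gx Dx] := ontoG _ _ Gv (mem_rVabelem abE ntE (delta_mx 0 k)).
  have : f v (abelem_rV abA ntA (coset _ x)) = delta_mx 0 k.
    rewrite fV /f -(commE _ x) ?Glift //; last by rewrite /rA abelem_rV_K ?mem_quotient.
    by rewrite -invg_comm /rE abelem_rV_V ?mem_commg // opprK Dx rVabelemK.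
  set w := abelem_rV _ _ _ => fvw; have : (v *m B *m w^T) 0 0 = 0 by rewrite vB0 mul0mx mxE.
  rewrite /B mulmx_sumr mulmx_suml summxE (bigD1 k) //= big1 => [|l ne_lk].
    rewrite -scalemxAr -scalemxAl mxE -AE fvw mxE !eqxx mulr1 addr0.
    by move/eqP; rewrite (negPf nz_yk).
  by rewrite -scalemxAr -scalemxAl mxE -AE fvw mxE (negPf ne_lk) andbF mulr0.
have := alternating_space_Fp p_pr (ltn0Sn _) altA regA.
rewrite (dim_abelemE abE ntE) (dim_abelemE abA ntA) => le_dim.
rewrite -card_quotient // (card_pgroup (abelem_pgroup abE)) (card_pgroup (abelem_pgroup abA)).
by rewrite -expnM leq_exp2l ?prime_gt1 // mulnC.
Qed.

(** * The centre in class three *)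

Section ClassThree.

Local Open Scope group_scope.

Lemma leq_indexgS (gT : finGroupType) (G H K : {group gT}) :
  H \subset K -> (#|G : K| <= #|G : H|)%N.
Proof. by move=> sHK; rewrite dvdn_leq ?indexgS. Qed.

Lemma sub_quotient_center (gT : finGroupType) (A : {set gT}) (G N : {group gT}) :
    A \subset G -> G \subset 'N(N) -> [~: A, G] \subset N ->
  A / N \subset 'Z(G / N).
Proof.
by move=> sAG nNG sAGN; rewrite subsetI quotientS // quotient_cents2r.
Qed.

(** The last inclusion puts the derived subgroup of [G / N] in its centre, so the bound on
    alternating forms applies there. *)
Lemma der1_index_bound (p : nat) (gT : finGroupType) (G N : {group gT}) :
    prime p -> p.-group G -> commutators_onto G ->
    N <| G -> N \subset G^`(1) -> [~: G^`(1), G] \subset N ->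
  (#|G^`(1) : N| ^ 2 <= #|G : G^`(1)|)%N.
Proof.
move=> p_pr pG ontoG /andP[sNG nNG] sND sDGN.
have := der1_square_bound p_pr (quotient_pgroup N pG) (commutators_onto_quotient nNG ontoG).
rewrite -quotient_der //= sub_quotient_center ?der_sub //= => /(_ isT).
rewrite card_quotient ?(subset_trans (der_sub 1 G)) //.
by rewrite index_quotient_eq ?der_sub ?(subset_trans (subsetIr _ _)).
Qed.

Variables (p : nat) (gT : finGroupType) (G : {group gT}).
Hypotheses (p_pr : prime p) (pG : p.-group G) (ontoG : commutators_onto G).

Let D := G^`(1)%G.
Let L := ('L_3(G))%G.
Let Z := ('Z(G))%G.
Let C := ('C_G(D))%G.

Hypotheses (L4 : 'L_4(G) = 1).

Lemma lcn3_center : L \subset Z.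
Proof.
by rewrite subsetI lcn_sub; apply/commG1P; rewrite -lcnSn; exact: L4.
Qed.

Lemma lcn3E : L :=: [~: D, G].
Proof. by rewrite /= lcnSn lcn2. Qed.

Lemma der1_abelian : abelian D.
Proof.
have DGG : [~: D, G, G] = 1 by rewrite -lcn3E -lcnSn; exact: L4.
by apply/commG1P/three_subgroup; rewrite ?[[~: G, D]]commGC.
Qed.

Hypotheses (ntL : L :!=: 1).

Lemma lcn3_der1_neq1 : D :!=: 1.
Proof. by apply: contraNneq ntL => D1; rewrite lcn3E D1 comm1G. Qed.

(** Induction along a chain of maximal subgroups from [Z] up to [U]. Adjoining [u] to [M] multiplies
    the right side by [p], and the left side by at most [#|L| = p], because the conjugates of [u]
    lie in [u *: L]. *)
Lemma cent_index_bound (U : {group gT}) :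
  #|L| = p -> Z \subset U -> U \subset D -> (#|G : 'C_G(U)| <= #|U : Z|)%N.
Proof.
move=> oL; elim: {U}_.+1 {-2}U (ltnSn #|U|) => // n IH U le_Un sZU sUD.
have [<-|[M maxM sZM]] := maximal_exists sZU.
  by rewrite (setIidPl _) ?indexgg // centsC subsetIr.
have ltMU : M \proper U := maxgroupp maxM.
have [sMU [u Uu Mu]] := properP ltMU.
have sUG : U \subset G := subset_trans sUD (der_sub 1 G).
have IHM : (#|G : 'C_G(M)| <= #|M : Z|)%N.
  by apply: IH; rewrite ?(leq_trans (proper_card ltMU)) ?(subset_trans sMU).
have defU : M <*> <[u]> = U.
  have sMuU : M <*> <[u]> \subset U by rewrite join_subG sMU cycle_subG.
  have [//|pr] := eqVproper sMuU; case/negP: Mu.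
  have [_ /(_ _ pr (joing_subl _ _)) <-] := maxgroupP maxM.
  by rewrite (subsetP (joing_subr _ _)) // cycle_id.
have sub_C : 'C_('C_G(M))[u] \subset 'C_G(U).
  by rewrite -defU centY cent_cycle setIA.
have leU : (#|G : 'C_G(U)| <= #|G : 'C_('C_G(M))[u]|)%N by exact: leq_indexgS sub_C.
apply: leq_trans leU _.
rewrite -(Lagrange_index _ (subsetIl _ _)) ?subsetIl // -(Lagrange_index sMU sZM).
rewrite (p_maximal_index (pgroupS sUG pG) maxM) mulnC leq_mul //.
rewrite index_cent1 -oL -(card_lcoset L u); apply: subset_leq_card.
apply/subsetP=> _ /imsetP[x /setIP[Gx _] ->]; rewrite mem_lcoset -commgEl lcn3E.
by rewrite mem_commg // (subsetP sUD).
Qed.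

(* With C the centraliser of G', commuting with an element of C outside G' is
   a condition modulo Z(G) that forces membership in C, and this gives
   [|G : G'| <= |G' : Z(G)|^2]. *)
Lemma camina_class3_center : #|L| = p -> 'Z(G) = L.
Proof.
move=> oL; have sDG : D \subset G := der_sub 1 G.
have sZD := center_sub_der1 ontoG lcn3_der1_neq1; have sLZ := lcn3_center.
have sLD := subset_trans sLZ sZD.
have nZG : G \subset 'N(Z) := normal_norm (center_normal G).
have nLG : L <| G := lcn_normal 3 G.
have bound : (#|D : L| ^ 2 <= #|G : D|)%N.
  by apply: (der1_index_bound p_pr pG ontoG) => //; rewrite -lcn3E.
have le_GC : (#|G : C| <= #|D : Z|)%N by exact: cent_index_bound.
have sDC : D \subset C.
  by rewrite subsetI sDG; exact: der1_abelian.
have sCG : C \subset G := subsetIl _ _.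
have sZC : Z \subset C := subset_trans sZD sDC.
(* Three subgroups lemma: [[~: C, G]] lies in [D], which [C] centralises. *)
have sCCZ : [~: C, C] \subset Z.
  rewrite subsetI (subset_trans (commgSS sCG sCG) sDG).
  have cCG_C : [~: C, G, C] = 1.
    apply/trivgP; apply: subset_trans (commSg C (commSg G sCG)) _.
    by apply/trivgP/commG1P; rewrite centsC subsetIr.
  by apply/commG1P; apply: three_subgroup => //; rewrite [[~: G, C]]commGC.
have nZC := subset_trans sCG nZG; have nZD := subset_trans sDG nZG.
have cardDZ : #|D / Z| = #|D : Z| by rewrite card_quotient.
(* The commutators of [x] fill [D], so the centraliser of [x] modulo [Z] has index at least
   [#|D : Z|], hence at least [#|G : C|]. As it contains [C / Z], the two agree. *)
have centC x w : x \in C :\: D -> w \in G -> [~ x, w] \in Z -> w \in C.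
  move=> /setDP[Cx D'x] Gw Zxw; have Gx := subsetP sCG x Cx.
  have sCcent : C / Z \subset 'C_(G / Z)[coset Z x].
    rewrite subsetI quotientS //= -cent_cycle -quotient_cycle ?(subsetP nZC) //.
    rewrite quotient_cents2r // (subset_trans _ sCCZ) // commgS // cycle_subG //.
  have le_cent : (#|G / Z : C / Z| <= #|G / Z : 'C_(G / Z)[coset Z x]|)%N.
    rewrite index_quotient_eq ?(subset_trans (subsetIr _ _) sZC) //.
    apply: leq_trans le_GC _; rewrite -cardDZ index_cent1 -(card_lcoset _ (coset Z x)).
    apply: subset_leq_card; apply/subsetP=> _ /lcosetP[_ /morphimP[d Nd Dd ->] ->].
    have [|y Gy <-] := @ontoG x d _ Dd; first by rewrite inE D'x.
    apply/imsetP; exists (coset Z y); first exact: mem_quotient.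
    rewrite -!morphM ?groupR ?(subsetP nZG) //=.
    by rewrite commgEl mulKVg morphJ ?(subsetP nZG).
  have eqC : C / Z = 'C_(G / Z)[coset Z x].
    apply/eqP; rewrite eqEcard sCcent -(leq_pmul2r (indexg_gt0 (G / Z) 'C_(G / Z)[coset Z x])).
    rewrite Lagrange ?subsetIl // -(Lagrange (quotientS Z sCG)).
    by rewrite leq_mul2l le_cent orbT.
  rewrite -(quotientGK (_ : Z <| C)) ?/normal ?sZC // mem_morphpre ?(subsetP nZG) //=.
  rewrite eqC inE mem_quotient //=; apply/cent1P/commgP.
  by rewrite -morphR ?(subsetP nZG) //= coset_id // -groupV invg_comm.
have [w Gw C'w] : exists2 w, w \in G & w \notin C.
  apply/subsetPn; apply: contra ntL => sGC; rewrite lcn3E.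
  by apply/eqP/commG1P; rewrite centsC (subset_trans sGC) ?subsetIr.
(* By [centC], only elements of [D / Z] can commute in [C / Z] with the image of [w], and the class
   of that image under [C / Z] lies in one coset of [D / Z]. *)
have le_CD : (#|C : D| <= #|D : Z|)%N.
  rewrite -cardDZ -(index_quotient_eq (subset_trans (subsetIr C Z) sZD) sDC nZC).
  have sCwD : 'C_(C / Z)[coset Z w] \subset D / Z.
    apply/subsetP=> _ /setIP[/morphimP[x Nx Cx ->] /cent1P/commgP cxw].
    apply: contraR C'w => D'x; apply: (centC x w _ Gw).
      by rewrite inE Cx andbT; apply: contra D'x; apply: mem_quotient.
    have Gx := subsetP sCG x Cx.
    apply: coset_idr; first exact: (subsetP nZG) (groupR Gx Gw).
    by rewrite morphR ?(subsetP nZG) //=; apply/eqP.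
  apply: leq_trans (leq_indexgS _ sCwD) _.
  rewrite index_cent1 -[#|D / Z|](card_lcoset _ (coset Z w)).
  apply: subset_leq_card; apply/subsetP=> _ /imsetP[_ /morphimP[x Nx Cx ->] ->].
  have Gx := subsetP sCG x Cx.
  rewrite mem_lcoset -commgEl -morphR ?(subsetP nZG) //= mem_quotient //.
  exact: mem_commg.
have: (#|D : L| ^ 2 <= #|D : Z| ^ 2)%N.
  apply: leq_trans bound _; rewrite -(Lagrange_index sCG sDC) -mulnn mulnC.
  exact: leq_mul.
rewrite leq_exp2r // -(Lagrange_index sZD sLZ) => le_ZL.
apply/eqP; rewrite eq_sym eqEsubset sLZ -indexg_eq1 eqn_leq indexg_gt0 andbT.
by rewrite -(leq_pmul2l (indexg_gt0 D Z)) muln1.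
Qed.

End ClassThree.

(** * Centres, kernels and codegrees of irreducible characters *)

Section Codegrees.

Local Open Scope group_scope.

Variables (p : nat) (gT : finGroupType) (G : {group gT}).
Hypothesis p_pr : prime p.

Lemma comm_cfcenter (i : Iirr G) : [~: 'Z('chi_i)%CF, G] \subset cfker 'chi_i.
Proof.
have nKG := normal_norm (cfker_normal 'chi_i).
rewrite -quotient_cents2 ?(subset_trans (cfcenter_sub _)) //.
by rewrite cfcenter_eq_center subsetIr.
Qed.

Lemma sub_cfcenter (i : Iirr G) (A : {set gT}) :
  A \subset G -> [~: A, G] \subset cfker 'chi_i -> A \subset 'Z('chi_i)%CF.
Proof.
move=> sAG sAGK; have nKG := normal_norm (cfker_normal 'chi_i).
rewrite -(quotientSGK (subset_trans sAG nKG) (normal_sub (cfker_center_normal _))).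
by rewrite cfcenter_eq_center sub_quotient_center.
Qed.

(* Conjugation by [y] multiplies the value at [g] by the scalar by which the
   central element [[~ g, y]] acts. *)
Lemma irr_supp_commg (i : Iirr G) (g y : gT) :
    g \in G -> y \in G -> 'chi_i g != 0%R ->
  [~ g, y] \in 'Z('chi_i)%CF -> [~ g, y] \in cfker 'chi_i.
Proof.
move=> Gg Gy; have Gz : [~ g, y] \in G by rewrite groupR.
have: 'chi_i (g * [~ g, y]) = 'chi_i g by rewrite -conjg_mulR cfunJ.
move: [~ g, y] Gz => z Gz; rewrite -irrRepr cfcenter_repr cfker_repr.
rewrite !cfunE Gg groupM // !mulrb !inE Gz repr_mxM // => chi_gz nz_chi.
case/is_scalar_mxP=> c Dz; rewrite Dz mul_mx_scalar mxtraceZ in chi_gz *.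
rewrite (mulIf nz_chi (etrans chi_gz (esym (mul1r _)))) mul1mx /=.
exact: eqxx.
Qed.

(** A nontrivial cyclic group of exponent [p] has order [p], so the kernel has index [p] times the
    squared degree. *)
Lemma codegree_cfcenter (i : Iirr G) :
    (forall z, z \in 'Z('chi_i)%CF -> z ^+ p \in cfker 'chi_i) ->
    ~~ ('Z('chi_i)%CF \subset cfker 'chi_i) ->
    ('chi_i 1%g ^+ 2 = #|G : 'Z('chi_i)%CF|%:R)%R ->
  codegree 'chi_i = (p%:R * sqrtC #|G : 'Z('chi_i)%CF|%:R)%R.
Proof.
set K := cfker _; set Z := 'Z(_)%CF => expK sZK chi1.
have [sKZ nKZ] := andP (cfker_center_normal 'chi_i).
have abZK : p.-abelem (Z / K).
  rewrite abelemE // cyclic_abelian ?cfcenter_cyclic //.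
  apply/exponentP=> _ /morphimP[z Nz Zz ->].
  by rewrite -morphX //= coset_id ?expK.
have oZK : #|Z : K| = p.
  rewrite -card_quotient // (cyclic_abelem_prime abZK) ?cfcenter_cyclic //.
  by rewrite -subG1 quotient_sub1.
rewrite /codegree -/K -(Lagrange_index (cfcenter_sub _) sKZ) oZK natrM -chi1.
by rewrite sqrCK ?char1_ge0 ?irr_char // expr2 mulrAC mulfK ?irr1_neq0 // mulrC.
Qed.

Hypotheses (pG : p.-group G) (ontoG : commutators_onto G).
Hypotheses (L4 : 'L_4(G) = 1) (ntD : G^`(1) != 1).

Let D := G^`(1)%G.
Let L := ('L_3(G))%G.

Lemma lcn3_sub_der1 : L \subset D.
Proof. by rewrite /= -lcn2 lcn_sub_leq. Qed.

Lemma comm_der1 : [~: D, G] = L.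
Proof. by rewrite /= lcnSn lcn2. Qed.

(** Otherwise [D = L = [~: D, G]], and the lower central series would be stuck at [D]. *)
Lemma lcn3_neq_der1 : ~~ (D \subset L).
Proof.
apply: contra ntD => sDL.
have eqDL : D :=: L by apply/eqP; rewrite eqEsubset sDL lcn3_sub_der1.
by rewrite -subG1 -L4 lcnSn -/L /= -[X in _ \subset [~: X, _]]eqDL comm_der1.
Qed.

Lemma lcn3_quotient_neq1 : (G / L)^`(1) != 1.
Proof.
have nLG : G \subset 'N(L) := normal_norm (lcn_normal 3 G).
rewrite -quotient_der // -subG1 quotient_sub1 ?(subset_trans (der_sub 1 G) nLG) //.
exact: lcn3_neq_der1.
Qed.

Lemma der1_lcn3_center : (G / L)^`(1) \subset 'Z(G / L).
Proof.
have nLG : G \subset 'N(L) := normal_norm (lcn_normal 3 G).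
by rewrite -quotient_der // sub_quotient_center ?der_sub ?comm_der1.
Qed.

Lemma expg_mem_der1_class3 g : g \in G -> g ^+ p \in D.
Proof.
move=> Gg; have nLG : G \subset 'N(L) := normal_norm (lcn_normal 3 G).
have := expg_mem_der1 (commutators_onto_quotient nLG ontoG) (quotient_pgroup _ pG)
  der1_lcn3_center lcn3_quotient_neq1 (mem_quotient L Gg).
rewrite -quotient_der // -morphX ?(subsetP nLG) //= => DLgp.
have nLD : L <| D := normalS lcn3_sub_der1 (der_sub 1 G) (lcn_normal 3 G).
rewrite -(quotientGK nLD) mem_morphpre //= ?(subsetP nLG) ?groupX //.
Qed.

Lemma expg_der1_mem_lcn3 z : z \in D -> z ^+ p \in L.
Proof.
move=> Dz; have nLG : G \subset 'N(L) := normal_norm (lcn_normal 3 G).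
have := der1_abelem (commutators_onto_quotient nLG ontoG) (quotient_pgroup _ pG)
  der1_lcn3_center p_pr.
have Nz := subsetP nLG _ (subsetP (der_sub 1 G) z Dz).
rewrite abelemE //= -quotient_der // => /andP[_ /exponentP/(_ _ (mem_quotient L Dz))].
rewrite -morphX //=; apply: coset_idr; exact: groupX.
Qed.

(** For generators [[~ d, y]] with [d] in [D], the [p]-th power is [[~ d, y ^+ p]], which is trivial
    since [y ^+ p] lies in the abelian group [D]. *)
Lemma lcn3_abelem : p.-abelem L.
Proof.
have sLZ : L \subset 'Z(G) := lcn3_center L4.
apply: abelemS (Ohm1_abelem (pgroupS (center_sub G) pG) (center_abelian G)).
rewrite /L /= lcnSn lcn2 gen_subG; apply/subsetP=> _ /imset2P[d y Dd Gy ->].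
rewrite /= (OhmE 1 (pgroupS (center_sub G) pG)) mem_gen // expn1; apply/LdivP.
have Lz : [~ d, y] \in L by rewrite -comm_der1 mem_commg.
have Zz := subsetP sLZ _ Lz; split=> //.
rewrite -commgX; last by case/centerP: Zz => _ cz; exact/esym/cz.
apply/eqP/commgP; have /centsP := der1_abelian L4; apply=> //.
exact: expg_mem_der1_class3.
Qed.

(** The commutators of an element of the centre of the character lie in the kernel; outside [D] they
    would fill [D]. *)
Lemma cfcenter_sub_der1 (i : Iirr G) :
  ~~ (D \subset cfker 'chi_i) -> 'Z('chi_i)%CF \subset D.
Proof.
move=> sDK; apply/subsetP=> g Zg; apply: contraR sDK => D'g.
have Gg := subsetP (cfcenter_sub _) g Zg.
apply/subsetP=> z Dz; have [|x Gx <-] := @ontoG g z _ Dz; first by rewrite inE D'g.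
by apply: subsetP (comm_cfcenter i) _ _; apply: mem_commg.
Qed.

Lemma codegree_lin (i : Iirr G) :
  'chi_i \is a linear_char -> i != 0%R -> codegree 'chi_i = p%:R%R.
Proof.
move=> lin_i nz_i; have sDK : D \subset cfker 'chi_i by rewrite -lin_irr_der1.
have eqZ : 'Z('chi_i)%CF = G.
  apply/eqP; rewrite eqEsubset cfcenter_sub; apply/subsetP=> x Gx.
  by rewrite irr_cfcenterE // normC_lin_char // lin_char1.
rewrite codegree_cfcenter eqZ ?indexgg ?sqrtC1 ?mulr1 //.
- by move=> z Gz; rewrite (subsetP sDK) // expg_mem_der1_class3.
- apply: contra nz_i => sGK; rewrite -irr_eq1; apply/eqP/cfun_inP=> x Gx.
  by rewrite cfun1E Gx cfker1 ?(subsetP sGK) // lin_char1.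
- by rewrite lin_char1 // expr1n.
Qed.

Lemma codegree_der1 (i : Iirr G) :
    L \subset cfker 'chi_i -> ~~ (D \subset cfker 'chi_i) ->
  codegree 'chi_i = (p%:R * sqrtC #|G : D|%:R)%R.
Proof.
move=> sLK sDK; have eqZ : 'Z('chi_i)%CF = D.
  apply/eqP; rewrite eqEsubset cfcenter_sub_der1 //=.
  by apply: sub_cfcenter (der_sub 1 G) _; rewrite comm_der1.
rewrite codegree_cfcenter eqZ //.
  by move=> z Dz; rewrite (subsetP sLK) // expg_der1_mem_lcn3.
by rewrite -eqZ irr1_abelian_bound // eqZ; apply: der_abelian.
Qed.

Lemma cfcenter_lcn3 (i : Iirr G) :
    ~~ (L \subset cfker 'chi_i) ->
  [/\ 'Z('chi_i)%CF = L, 'Z(G) = L & 'chi_i \in 'CF(G, L)].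
Proof.
move=> sLK; have sLD := lcn3_sub_der1; have sDG := der_sub 1 G.
have sDK : ~~ (D \subset cfker 'chi_i) by apply: contra sLK; apply: subset_trans.
have sLZ : L \subset 'Z(G) := lcn3_center L4.
have sZZi : 'Z(G) \subset 'Z('chi_i)%CF by rewrite -cap_cfcenter_irr bigcap_inf.
have sLZi := subset_trans sLZ sZZi.
(* Factoring out [K] leaves an image of [L] that is elementary abelian and embeds in the cyclic
   group Z(chi)/ker chi, hence has order [p]. *)
pose K := (cfker 'chi_i :&: L)%G.
have nKG : G \subset 'N(K) by rewrite normsI // ?normal_norm ?cfker_normal ?lcn_normal.
have LK : 'L_3(G / K) = L / K by rewrite -morphim_lcn.
have oLK : #|L / K| = p.
  have nkL : L \subset 'N(cfker 'chi_i).
    by rewrite (subset_trans (lcn_sub 3 G)) // normal_norm ?cfker_normal.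
  rewrite (card_isog (second_isog nkL)).
  rewrite (cyclic_abelem_prime (quotient_abelem _ lcn3_abelem)) //.
    by apply: cyclicS (cfcenter_cyclic 'chi_i); apply: quotientS.
  by rewrite -subG1 quotient_sub1.
have ZGK : 'Z(G / K) = L / K.
  rewrite -LK; apply: (camina_class3_center p_pr (quotient_pgroup K pG)).
  - exact: commutators_onto_quotient.
  - by rewrite -morphim_lcn // L4 morphim1.
  - by rewrite /= LK -cardG_gt1 oLK prime_gt1.
  - by rewrite /= LK.
have memL g : g \in D -> (forall x, x \in G -> [~ g, x] \in cfker 'chi_i) -> g \in L.
  move=> Dg gK; have Gg := subsetP sDG g Dg.
  have nKL : K <| L by rewrite /normal subsetIr (subset_trans (lcn_sub 3 G)).
  rewrite -(quotientGK nKL) mem_morphpre ?(subsetP nKG) //= -ZGK.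
  rewrite inE mem_quotient //=; apply/centP=> _ /morphimP[x Nx Gx ->].
  apply/commgP; rewrite -morphR ?(subsetP nKG) //= coset_id //.
  by rewrite inE gK //= -comm_der1 mem_commg.
have sZiL : 'Z('chi_i)%CF \subset L.
  apply/subsetP=> g Zg; apply: memL => [|x Gx].
    exact: (subsetP (cfcenter_sub_der1 sDK)).
  by apply: subsetP (comm_cfcenter i) _ _; apply: mem_commg.
have eqZi : 'Z('chi_i)%CF = L by apply/eqP; rewrite eqEsubset sZiL.
split=> //; first by apply/eqP; rewrite eqEsubset sLZ -eqZi sZZi.
(* Where the character is nonzero, commutators of [g] lying in [L] are in the kernel. If [g] were
   outside [D], these would exhaust [L]; so [g] is in [D], all its commutators are in [L], and
   [memL] applies. *)
apply/cfun_onP=> g; apply: contraNeq => nz_chi.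
have Gg : g \in G by apply: contraR nz_chi => /cfun0->.
have suppK x : x \in G -> [~ g, x] \in L -> [~ g, x] \in cfker 'chi_i.
  by move=> Gx; rewrite -eqZi; apply: irr_supp_commg.
have Dg : g \in D.
  apply: contraR sLK => D'g; apply/subsetP=> z Lz.
  have Dz := subsetP sLD z Lz.
  have [|x Gx zE] := @ontoG g z _ Dz; first by rewrite inE D'g.
  by rewrite -zE suppK ?zE.
by apply: memL => // x Gx; rewrite suppK // -comm_der1 mem_commg.
Qed.

Lemma codegree_center (i : Iirr G) :
    ~~ (L \subset cfker 'chi_i) ->
  codegree 'chi_i = (p%:R * sqrtC #|G : 'Z(G)|%:R)%R.
Proof.
move=> sLK; have [eqZi eqZ suppL] := cfcenter_lcn3 sLK.
rewrite codegree_cfcenter eqZi ?eqZ //.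
  move=> z Lz; have := lcn3_abelem; rewrite abelemE // => /andP[_ /exponentP->] //.
by apply/eqP; rewrite -eqZi irr1_bound eqZi.
Qed.

End Codegrees.

(** * The set of codegrees *)

Lemma mem_codegrees (gT : finGroupType) (G : {group gT}) (i : Iirr G) :
  codegree 'chi_i \in codegrees G.
Proof. by apply: map_f; apply: mem_irr. Qed.

(** Classes 2 and 3 are treated together: characters nontrivial on the third term exist exactly when
    that term is nontrivial. *)
Lemma codegrees_class3 (p : nat) (gT : finGroupType) (G : {group gT}) :
    prime p -> camina_pgroup p G -> ('L_4(G) = 1)%g -> (G^`(1) != 1)%g ->
  codegrees G =i
    [:: 1; p%:R; p%:R * sqrtC (#|G / G^`(1)|%g%:R)]
      ++ (if ('L_3(G) == 1)%g then [::]
          else [:: p%:R * sqrtC (#|G / 'Z(G)|%g%:R)]).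
Proof.
move=> p_pr camG L4 ntD; have ontoG := camina_commutators_onto camG.
have [pG _] := camG.
rewrite !card_quotient ?der_norm ?gFnorm //.
have codD := codegree_der1 p_pr pG ontoG.
have codZ := codegree_center p_pr pG ontoG L4 ntD.
have codL := codegree_lin p_pr pG ontoG L4 ntD.
have cod1 : codegree 'chi[G]_0 = 1.
  by rewrite /codegree cfker_irr0 indexgg irr0 cfun11 divr1.
have L3triv : ('L_3(G) == 1)%g -> forall i : Iirr G, 'L_3(G) \subset cfker 'chi_i.
  by move=> /eqP-> i; apply: sub1G.
move=> a; apply/idP/idP.
  case/mapP=> _ /irrP[i ->] ->; rewrite mem_cat !inE.
  have [sDK|sDK] := boolP (G^`(1)%g \subset cfker 'chi_i).
    have [->|nz_i] := eqVneq i 0; first by rewrite cod1 eqxx.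
    by rewrite codL ?lin_irr_der1 // eqxx orbT.
  have [sLK|sLK] := boolP ('L_3(G) \subset cfker 'chi_i).
    by rewrite codD // eqxx !orbT.
  case: ifP => [/L3triv/(_ i)|_]; first by rewrite (negPf sLK).
  by rewrite codZ // inE eqxx !orbT.
rewrite mem_cat !inE -!orbA => /or4P[/eqP->|/eqP->|/eqP->|].
- by rewrite -cod1 mem_codegrees.
(* The kernels of the linear characters intersect in G', which is proper in [G]. *)
- have [i lin_i nz_i] : exists2 i : Iirr G, 'chi_i \is a linear_char & i != 0.
    apply/exists_inP; apply: contraT; rewrite negb_exists_in => /forall_inP lin0.
    have ntG : G :!=: 1%g by apply: contraNneq ntD => ->; rewrite derg1 comm1G.
    have := sol_der1_proper (pgroup_sol pG) (subxx G) ntG.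
    rewrite properE -{2}cap_cfker_lin_irr => /andP[_ /bigcapsP[]] i lin_i.
    by have := lin0 i lin_i; rewrite negbK => /eqP->; rewrite cfker_irr0.
  by rewrite -(codL i) // mem_codegrees.
(* The irreducible kernels containing the third term intersect in it, and G' is not inside it. *)
- have [i sLK sDK] : exists2 i : Iirr G,
      'L_3(G) \subset cfker 'chi_i & ~~ (G^`(1)%g \subset cfker 'chi_i).
    apply/exists_inP; apply: contraT; rewrite negb_exists_in => /forall_inP sDK.
    have /negP[] := lcn3_neq_der1 L4 ntD.
    rewrite /= -(cap_cfker_normal (lcn_normal 3 G)).
    by apply/bigcapsP=> i sLK; have := sDK i sLK; rewrite negbK.
  by rewrite -(codD i) // mem_codegrees.
case: ifP => // ntL; rewrite inE => /eqP->.
have [i sLK] : exists i : Iirr G, ~~ ('L_3(G) \subset cfker 'chi_i).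
  apply/existsP; apply: contraFT ntL; rewrite negb_exists => /forallP sLK.
  rewrite -subG1 -(TI_cfker_irr G); apply/bigcapsP=> i _.
  by have := sLK i; rewrite negbK.
by rewrite -(codZ i) // mem_codegrees.
Qed.

Theorem theorem2p6 (p : nat) (gT : finGroupType) (G : {group gT})
    (hp : prime p) (hG : camina_pgroup p G) :
  (nil_class G = 2%N ->
     codegrees G =i
       [:: 1; p%:R; p%:R * sqrtC (#|G / 'Z(G)|%g%:R)])
  /\
  (nil_class G = 3%N ->
     codegrees G =i
       [:: 1; p%:R; p%:R * sqrtC (#|G / G^`(1)|%g%:R);
           p%:R * sqrtC (#|G / 'Z(G)|%g%:R)]).
Proof.
have [pG _] := hG; have nilG := pgroup_nil pG.
(* The series is indexed from ['L_1(G) = G], whence the shift by one. *)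
have clP n : (nil_class G <= n)%N = ('L_n.+1(G) == 1%g).
  exact: (sameP (lcn_nil_classP n nilG) eqP).
have ntD : (1 < nil_class G)%N -> (G^`(1) != 1)%g.
  by rewrite ltnNge clP lcn2.
split=> cl.
  have L3 : ('L_3(G) = 1)%g by apply/eqP; rewrite -clP cl.
  have L4 : ('L_4(G) = 1)%g by apply/eqP; rewrite -clP cl.
  have {}ntD : (G^`(1) != 1)%g by rewrite ntD ?cl.
  (* In class 2 this turns the index of G' into that of the centre. *)
  have -> : ('Z(G) = G^`(1))%g.
    apply/eqP; rewrite eqEsubset (center_sub_der1 (camina_commutators_onto hG)) //=.
    by rewrite subsetI der_sub; apply/commG1P; rewrite -L3 lcnSn lcn2.
  by move=> a; rewrite (codegrees_class3 hp hG) // L3 eqxx cats0.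
have L4 : ('L_4(G) = 1)%g by apply/eqP; rewrite -clP cl.
have ntL : ('L_3(G) == 1)%g = false by rewrite -clP cl.
by move=> a; rewrite (codegrees_class3 hp hG) ?ntD ?cl // ntL.
Qed.
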